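(* Let $V=-y\,\frac{\partial}{\partial x}+x\,\frac{\partial}{\partial y}$ on Euclidean space $\mathbb{E}^3$, and let $\gamma:I\to\mathbb{E}^3$ be a smooth curve, parametrized by arc length on an interval $I\subset\mathbb{R}$ and not meeting the $z$-axis, which makes a constant angle $\theta$ with $V$. Let $s_0\in I$. Then, up to vertical translations and rotations around the $z$-axis, $\gamma$ is given in cylindrical coordinates by $\gamma(s)=\big(r(s)\cos\phi(s),\,r(s)\sin\phi(s),\,z(s)\big)$ with $$r(s)=r_0+\sin\theta\int_{s_0}^s\cos\omega(\zeta)\,d\zeta,\qquad z(s)=\sin\theta\int_{s_0}^s\sin\omega(\zeta)\,d\zeta,\qquad \phi(s)=\cos\theta\int_{s_0}^s\frac{d\zeta}{r(\zeta)},$$ where $r_0\in\mathbb{R}$ and $\omega$ is a smooth function on $I$.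
   Context: At a point $(x,y,z)$ the vector field $V$ takes the value $(-y,x,0)$; it is non-zero away from the $z$-axis. A unit-speed curve $\gamma$ makes constant angle $\theta$ with $V$ if $\langle\gamma'(s),V_{\gamma(s)}\rangle=\|V_{\gamma(s)}\|\cos\theta$ for all $s\in I$. Here $r(s)>0$ denotes the distance from $\gamma(s)$ to the $z$-axis. *)

(* Defs.v *)
From Stdlib Require Import Reals.
From Coquelicot Require Import Coquelicot.
Open Scope R_scope.

(* Open, half-open or closed, bounded or not, but not reduced to a point, so
   that derivatives within the interval are unique. *)
Definition interval (I : R -> Prop) : Prop :=
  (exists a b, I a /\ I b /\ a < b) /\
  (forall a b s, I a -> I b -> a <= s <= b -> I s).

(* [D n] is the n-th derivative of [f].  [D_in] takes difference quotients
   inside [I] only, so derivatives are one-sided at an endpoint of [I] and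
   values outside [I] are irrelevant. *)
Definition smooth_on (I : R -> Prop) (f : R -> R) : Prop :=
  exists D : nat -> R -> R,
    (forall s, I s -> D O s = f s) /\
    (forall n s, I s -> D_in (D n) (D (S n)) I s).

Definition E3 : Type := (R * R * R)%type.

Definition xcoord (p : E3) : R := fst (fst p).
Definition ycoord (p : E3) : R := snd (fst p).
Definition zcoord (p : E3) : R := snd p.

Definition inner (u v : E3) : R :=
  xcoord u * xcoord v + ycoord u * ycoord v + zcoord u * zcoord v.
Definition enorm (u : E3) : R := sqrt (inner u u).

Definition smooth_curve_on (I : R -> Prop) (g : R -> E3) : Prop :=
  smooth_on I (fun s => xcoord (g s)) /\
  smooth_on I (fun s => ycoord (g s)) /\
  smooth_on I (fun s => zcoord (g s)).

Definition velocity_on (I : R -> Prop) (g dg : R -> E3) : Prop :=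
  forall s, I s ->
    D_in (fun t => xcoord (g t)) (fun t => xcoord (dg t)) I s /\
    D_in (fun t => ycoord (g t)) (fun t => ycoord (dg t)) I s /\
    D_in (fun t => zcoord (g t)) (fun t => zcoord (dg t)) I s.

Definition V (p : E3) : E3 := (- ycoord p, xcoord p, 0).

Definition on_z_axis (p : E3) : Prop := xcoord p = 0 /\ ycoord p = 0.

Definition dist_z_axis (p : E3) : R := sqrt (xcoord p ^ 2 + ycoord p ^ 2).

(* [dg] is the velocity of [g]. *)
Definition constant_angle_with_V
    (I : R -> Prop) (g dg : R -> E3) (theta : R) : Prop :=
  forall s, I s -> inner (dg s) (V (g s)) = enorm (V (g s)) * cos theta.

Definition rotate_z (alpha : R) (p : E3) : E3 :=
  (cos alpha * xcoord p - sin alpha * ycoord p,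
   sin alpha * xcoord p + cos alpha * ycoord p,
   zcoord p).

Definition translate_z (c : R) (p : E3) : E3 :=
  (xcoord p, ycoord p, zcoord p + c).

Definition cylindrical (r phi z : R) : E3 := (r * cos phi, r * sin phi, z).

(* Main.v *)
Require Import Defs.
From Stdlib Require Import Reals.
From Coquelicot Require Import Coquelicot.
From Stdlib Require Import Lra ClassicalEpsilon.
Open Scope R_scope.

(* Both the profile angle [omega] and the cylindrical angle [phi] are lifts of
   plane unit vectors: a differentiable unit vector [(u, v)] equals
   [(cos W, sin W)] for a suitable primitive [W] of [u v' - v u'].  With [r] the
   distance to the axis, the angle condition reads [x y' - y x' = r cos theta],
   so for the direction [(x, y) / r] this primitive is that of [cos theta / r];
   together with unit speed it gives [r'^2 + z'^2 = sin^2 theta], so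
   [(r', z') = sin theta (cos omega, sin omega)], with [omega] smooth because
   [omega'] is.  If [sin theta = 0], then [r' = z' = 0] and any [omega] works. *)

(** * Calculus of derivatives relative to an interval, one-sided at its endpoints *)

Definition D_on (I : R -> Prop) (f df : R -> R) : Prop :=
  forall s, I s -> D_in f df I s.

Lemma D_on_ext (I : R -> Prop) (f g df dg : R -> R) :
  (forall s, I s -> f s = g s) -> (forall s, I s -> df s = dg s) ->
  D_on I f df -> D_on I g dg.
Proof.
intros Hf Hd H s Hs eps Heps.
destruct (H s Hs eps Heps) as [d [Hd0 Hd1]].
exists d; split; [exact Hd0 |].
intros t [[It Nt] Ht].
rewrite <- (Hf t It), <- (Hf s Hs), <- (Hd s Hs).
apply Hd1; repeat split; assumption.
Qed.

(** Since [I] is not reduced to a point, each [s] in [I] is an accumulation point of the rest of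
    [I], and a limit at such a point is unique. *)
Lemma D_on_unique (I : R -> Prop) (f d1 d2 : R -> R) :
  interval I -> D_on I f d1 -> D_on I f d2 -> forall s, I s -> d1 s = d2 s.
Proof.
intros [[a [b [Ia [Ib Hab]]]] Hconv] H1 H2 s Is.
apply (single_limit _ (D_x I s) (d1 s) (d2 s) s) with (2 := H1 s Is) (3 := H2 s Is).
intros e He.
(* A point of [I] other than [s] within [e] of it: move towards [a] if [b <= s], towards [b]
   otherwise. *)
destruct (Rle_or_lt b s) as [Hbs | Hsb].
- exists (Rmax a (s - e / 2)).
  assert (Hm : a <= Rmax a (s - e / 2) < s /\ s - e < Rmax a (s - e / 2)).
  { unfold Rmax; destruct Rle_dec; lra. }
  split; [split; [unfold D_x; apply (Hconv a s) |] |]; try assumption; try lra.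
  unfold Rdist; rewrite Rabs_left; lra.
- exists (Rmin b (s + e / 2)).
  assert (Hm : s < Rmin b (s + e / 2) <= b /\ Rmin b (s + e / 2) < s + e).
  { unfold Rmin; destruct Rle_dec; lra. }
  split; [split; [unfold D_x; apply (Hconv s b) |] |]; try assumption; try lra.
  unfold Rdist; rewrite Rabs_right; lra.
Qed.

Lemma D_on_comp (I : R -> Prop) (f df g dg : R -> R) :
  D_on I f df -> (forall s, I s -> is_derive g (f s) (dg (f s))) ->
  D_on I (fun s => g (f s)) (fun s => df s * dg (f s)).
Proof.
intros Hf Hg s Is.
(* The chain rule restricts to points of [I] whose image satisfies [no_cond], which is all of
   [I]. *)
apply (D_in_imp _ _ (Dgf I no_cond f)).
{ intros t It; split; [exact It | exact Logic.I]. }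
apply Dcomp; [exact (Hf s Is) |].
apply derivable_pt_lim_D_in, is_derive_Reals, Hg, Is.
Qed.

Lemma D_on_plus (I : R -> Prop) (f df g dg : R -> R) :
  D_on I f df -> D_on I g dg ->
  D_on I (fun s => f s + g s) (fun s => df s + dg s).
Proof. intros Hf Hg s Is; apply Dadd; auto. Qed.

Lemma D_on_mult (I : R -> Prop) (f df g dg : R -> R) :
  D_on I f df -> D_on I g dg ->
  D_on I (fun s => f s * g s) (fun s => df s * g s + f s * dg s).
Proof. intros Hf Hg s Is; apply Dmult; auto. Qed.

Lemma D_on_const (I : R -> Prop) (c : R) : D_on I (fun _ => c) (fun _ => 0).
Proof. intros s Is; apply Dconst. Qed.

(** The derivative is written with products, constants and inverses only, so that it matches the
    constructors of [smooth_expr] below. *)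
Lemma D_on_inv (I : R -> Prop) (f df : R -> R) :
  (forall s, I s -> f s <> 0) -> D_on I f df ->
  D_on I (fun s => / f s) (fun s => df s * (- 1 * (/ f s * / f s))).
Proof.
intros Hn Hf; apply (D_on_comp I f df Rinv (fun y => - 1 * (/ y * / y)) Hf).
intros s Is; specialize (Hn s Is); auto_derive; [exact Hn | field; exact Hn].
Qed.

Lemma D_on_sqrt (I : R -> Prop) (f df : R -> R) :
  (forall s, I s -> 0 < f s) -> D_on I f df ->
  D_on I (fun s => sqrt (f s)) (fun s => df s * (/ 2 * / sqrt (f s))).
Proof.
intros Hp Hf; apply (D_on_comp I f df sqrt (fun y => / 2 * / sqrt y) Hf).
intros s Is; specialize (Hp s Is); auto_derive; [exact Hp |].
field; apply Rgt_not_eq, sqrt_lt_R0, Hp.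
Qed.

(** * Integrals and primitives of functions continuous relative to an interval *)

Definition clamp (a b t : R) : R := Rmax a (Rmin b t).

Lemma clamp_in (a b t : R) : a <= b -> a <= clamp a b t <= b.
Proof.
unfold clamp, Rmax, Rmin; destruct (Rle_dec b t); destruct Rle_dec; lra.
Qed.

Lemma clamp_id (a b t : R) : a <= t <= b -> clamp a b t = t.
Proof.
unfold clamp, Rmax, Rmin; destruct (Rle_dec b t); destruct Rle_dec; lra.
Qed.

Lemma clamp_contract (a b t s : R) :
  a <= b -> Rabs (clamp a b t - clamp a b s) <= Rabs (t - s).
Proof.
intros Hab; unfold clamp, Rmax, Rmin.
destruct (Rle_dec b t); destruct (Rle_dec b s);
  repeat destruct Rle_dec; unfold Rabs; repeat destruct Rcase_abs; lra.
Qed.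

(** [clamp] is a 1-Lipschitz retraction onto [[a, b]]. Composing with it turns continuity relative
    to [I] into continuity on the whole line, the form used for integrability and the mean value
    theorem. *)
Lemma clamp_continuity (I : R -> Prop) (f : R -> R) (a b : R) :
  interval I -> I a -> I b -> a <= b ->
  (forall s, I s -> continue_in f I s) ->
  forall t, continuity_pt (fun u => f (clamp a b u)) t.
Proof.
intros [_ Hconv] Ia Ib Hab Hc t eps Heps.
assert (Hin : forall u, I (clamp a b u)).
{ intros u; apply (Hconv a b); auto using clamp_in. }
destruct (Hc (clamp a b t) (Hin t) eps Heps) as [d [Hd Hd1]].
exists d; split; [exact Hd |].
intros u [_ Hu]; simpl in *; unfold Rdist in *.
(* [continue_in] only speaks of points different from the base point, but [clamp] may identify
   distinct [u] and [t]. *)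
destruct (Req_dec (clamp a b u) (clamp a b t)) as [E | E].
- rewrite E, Rminus_diag, Rabs_R0; exact Heps.
- apply Hd1; split; [split; [apply Hin | apply not_eq_sym, E] |].
  apply Rle_lt_trans with (2 := Hu), clamp_contract, Hab.
Qed.

Lemma ex_RInt_le_in (I : R -> Prop) (f : R -> R) (a b : R) :
  interval I -> (forall s, I s -> continue_in f I s) ->
  I a -> I b -> a <= b -> ex_RInt f a b.
Proof.
intros HI Hc Ia Ib Hab.
apply (ex_RInt_ext (fun u => f (clamp a b u))).
- intros u; rewrite Rmin_left, Rmax_right by exact Hab; intros Hu.
  rewrite clamp_id; [reflexivity | lra].
- apply (ex_RInt_continuous (V := R_CompleteNormedModule)); intros u _.
  apply continuity_pt_filterlim.
  exact (clamp_continuity I f a b HI Ia Ib Hab Hc u).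
Qed.

Lemma ex_RInt_in (I : R -> Prop) (f : R -> R) (a b : R) :
  interval I -> (forall s, I s -> continue_in f I s) ->
  I a -> I b -> ex_RInt f a b.
Proof.
intros HI Hc Ia Ib.
destruct (Rle_or_lt a b) as [H | H].
- exact (ex_RInt_le_in I f a b HI Hc Ia Ib H).
- apply ex_RInt_swap, (ex_RInt_le_in I f b a HI Hc Ib Ia); lra.
Qed.

(** For [c] the value of [f] at an endpoint, this bounds the error of the difference quotient of the
    integral. The case [b < a] follows by exchanging the bounds. *)
Lemma abs_RInt_sub_const_le (f : R -> R) (a b c M : R) :
  ex_RInt f a b ->
  (forall t, Rmin a b <= t <= Rmax a b -> Rabs (f t - c) <= M) ->
  Rabs (RInt f a b - c * (b - a)) <= M * Rabs (b - a).
Proof.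
assert (Hle : forall a b, a <= b -> ex_RInt f a b ->
  (forall t, a <= t <= b -> Rabs (f t - c) <= M) ->
  Rabs (RInt f a b - c * (b - a)) <= M * (b - a)).
{ clear a b; intros a b Hab Hex HM.
  rewrite (Rmult_comm M).
  apply (norm_RInt_le_const (V := R_NormedModule) (fun t => f t - c) a b); [exact Hab | exact HM |].
  replace (RInt f a b - c * (b - a)) with (minus (RInt f a b) (scal (b - a) c)).
  - apply (is_RInt_minus (V := R_NormedModule));
      [exact (RInt_correct f a b Hex) | apply (is_RInt_const (V := R_NormedModule))].
  - unfold minus, plus, opp, scal; simpl; unfold mult; simpl; ring. }
intros Hex HM.
destruct (Rle_or_lt a b) as [H | H].
- rewrite Rmin_left, Rmax_right in HM by exact H.
  rewrite (Rabs_right (b - a)) by lra; auto.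
- rewrite Rmin_right, Rmax_left in HM by lra.
  rewrite (Rabs_left (b - a)) by lra.
  rewrite <- (opp_RInt_swap f b a) by (apply ex_RInt_swap; exact Hex).
  replace (opp (RInt f b a) - c * (b - a)) with (- (RInt f b a - c * (a - b)))
    by (unfold opp; simpl; ring).
  rewrite Rabs_Ropp; replace (- (b - a)) with (a - b) by ring.
  apply Hle; [lra | apply ex_RInt_swap; exact Hex | exact HM].
Qed.

(** The difference quotient between [s] and [t] is the mean of [f] over that segment, which lies in
    [I] by convexity and on which [f] is close to [f s]. *)
Lemma D_on_RInt (I : R -> Prop) (f : R -> R) (s0 : R) :
  interval I -> (forall s, I s -> continue_in f I s) -> I s0 ->
  D_on I (fun s => RInt f s0 s) f.
Proof.
intros HI Hc I0 s Is eps Heps.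
(* Half of [eps], because the integral estimate is not strict while the limit asks for a strict
   bound. *)
destruct (Hc s Is (eps / 2)) as [d [Hd Hd1]]; [lra |].
exists d; split; [exact Hd |].
intros t [[It Nt] Ht]; simpl in *; unfold Rdist in *.
assert (Hst : RInt f s0 t - RInt f s0 s = RInt f s t).
{ rewrite <- (RInt_Chasles f s0 s t) by (apply (ex_RInt_in I); assumption).
  unfold plus; simpl; ring. }
rewrite Hst.
assert (Hts : 0 < Rabs (t - s)) by (apply Rabs_pos_lt, Rminus_eq_contra, not_eq_sym, Nt).
replace (RInt f s t / (t - s) - f s)
  with ((RInt f s t - f s * (t - s)) / (t - s)) by (field; apply Rminus_eq_contra, not_eq_sym, Nt).
rewrite Rabs_div by (apply Rminus_eq_contra, not_eq_sym, Nt).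
apply Rle_lt_trans with (eps / 2); [| lra].
apply Rle_div_l; [exact Hts |].
apply abs_RInt_sub_const_le; [apply (ex_RInt_in I); assumption |].
intros u Hu.
destruct (Req_dec u s) as [-> | Nu].
{ rewrite Rminus_diag, Rabs_R0; lra. }
left; apply Hd1; split.
- split; [| apply not_eq_sym, Nu].
  destruct HI as [_ Hconv].
  revert Hu; unfold Rmin, Rmax; destruct Rle_dec; intros Hu.
  + apply (Hconv s t); assumption.
  + apply (Hconv t s); assumption.
- apply Rle_lt_trans with (2 := Ht).
  revert Hu; unfold Rmin, Rmax; destruct Rle_dec; intros Hu;
  unfold Rabs; repeat destruct Rcase_abs; lra.
Qed.

(** The mean value theorem applies to [f] composed with [clamp a b]: this is continuous everywhere
    and has the ordinary derivative 0 inside [(a, b)]. *)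
Lemma D_on_zero_const (I : R -> Prop) (f : R -> R) :
  interval I -> D_on I f (fun _ => 0) ->
  forall a b, I a -> I b -> f a = f b.
Proof.
intros HI Hf.
assert (Hlt : forall a b, I a -> I b -> a < b -> f a = f b).
{ intros a b Ia Ib Hab.
  destruct (MVT_gen (fun u => f (clamp a b u)) a b (fun _ => 0)) as [c [_ Hc]].
  - rewrite Rmin_left, Rmax_right by lra; intros t Ht.
    assert (It : I t) by (apply (proj2 HI a b); trivial; lra).
    apply is_derive_Reals.
    apply (proj1 (derivable_pt_lim_D_in _ (fun _ => 0) t)).
    intros eps Heps; destruct (Hf t It eps Heps) as [d [Hd Hd1]].
    (* This radius keeps [u] inside [(a, b)], where [clamp] is the identity. *)
    exists (Rmin d (Rmin (t - a) (b - t))); split.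
    { repeat apply Rmin_pos; lra. }
    intros u [[_ Nu] Hu]; simpl in *; unfold Rdist in *.
    assert (Hud := Rlt_le_trans _ _ _ Hu (Rmin_l _ _)).
    assert (Hu2 := Rlt_le_trans _ _ _ Hu (Rmin_r _ _)).
    assert (Hua := Rlt_le_trans _ _ _ Hu2 (Rmin_l _ _)).
    assert (Hub := Rlt_le_trans _ _ _ Hu2 (Rmin_r _ _)).
    apply Rabs_def2 in Hua; apply Rabs_def2 in Hub.
    rewrite !clamp_id by lra.
    apply Hd1; split; [split; [| exact Nu] | exact Hud].
    apply (proj2 HI a b); trivial; lra.
  - intros t _; apply (clamp_continuity I); trivial; [lra |].
    intros s Is; exact (cont_deriv _ _ _ _ (Hf s Is)).
  - rewrite !clamp_id in Hc by lra; lra. }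
intros a b Ia Ib.
destruct (Rtotal_order a b) as [H | [-> | H]]; [auto | reflexivity | symmetry; auto].
Qed.

(** The difference of [k] times the integral and [F] has derivative zero. The factor stays outside
    the integral as in the formulas for [r] and [z], where [k = sin theta] may vanish. *)
Lemma scal_RInt_D_on (I : R -> Prop) (F f : R -> R) (k : R) :
  interval I -> D_on I F (fun s => k * f s) ->
  (forall s, I s -> continue_in f I s) ->
  forall a b, I a -> I b -> k * RInt f a b = F b - F a.
Proof.
intros HI HF Hc a b Ia Ib.
assert (H : k * RInt f a a + - 1 * F a = k * RInt f a b + - 1 * F b).
{ apply (D_on_zero_const I (fun s => k * RInt f a s + - 1 * F s) HI); trivial.
  apply (D_on_ext I (fun s => k * RInt f a s + - 1 * F s) _
           (fun s => (0 * RInt f a s + k * f s) + (0 * F s + - 1 * (k * f s))) _);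
    [reflexivity | intros; ring |].
  apply D_on_plus; apply D_on_mult; try apply D_on_const;
    [apply D_on_RInt; assumption | exact HF]. }
rewrite RInt_point in H; unfold zero in H; simpl in H; lra.
Qed.

(** * Smooth functions on an interval and their closure properties *)

Lemma smooth_on_D_on (I : R -> Prop) (f : R -> R) :
  smooth_on I f -> exists df, smooth_on I df /\ D_on I f df.
Proof.
intros [D [H0 HD]]; exists (D 1%nat); split.
- exists (fun n => D (S n)); split; [reflexivity | intros n; apply HD].
- apply (D_on_ext I (D 0%nat) f (D 1%nat)); [exact H0 | reflexivity | exact (HD 0%nat)].
Qed.

Lemma smooth_on_ext (I : R -> Prop) (f g : R -> R) :
  (forall s, I s -> f s = g s) -> smooth_on I f -> smooth_on I g.
Proof.
intros E [D [H0 HD]]; exists D; split; [| exact HD].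
intros s Is; rewrite H0, E; trivial.
Qed.

(** By uniqueness, a given derivative agrees on [I] with the one in the sequence that witnesses
    smoothness. *)
Lemma smooth_on_derivative (I : R -> Prop) (f df : R -> R) :
  interval I -> smooth_on I f -> D_on I f df -> smooth_on I df.
Proof.
intros HI Hf Hdf; destruct (smooth_on_D_on I f Hf) as [d [Hd Hfd]].
apply (smooth_on_ext I d); [| exact Hd].
exact (D_on_unique I f d df HI Hfd Hdf).
Qed.

Lemma smooth_on_primitive (I : R -> Prop) (F f : R -> R) :
  D_on I F f -> smooth_on I f -> smooth_on I F.
Proof.
intros HF [D [H0 HD]].
(* The derivatives of [f], shifted by one place, with [F] put in front. *)
exists (fun n => match n with O => F | S m => D m end); split; [reflexivity |].
intros [| n]; [| exact (HD n)].
apply (D_on_ext I F F f); [reflexivity | | exact HF].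
intros s Is; symmetry; exact (H0 s Is).
Qed.

Lemma smooth_on_continue_in (I : R -> Prop) (f : R -> R) :
  smooth_on I f -> forall s, I s -> continue_in f I s.
Proof.
intros Hf s Is; destruct (smooth_on_D_on I f Hf) as [d [_ Hd]].
exact (cont_deriv _ _ _ _ (Hd s Is)).
Qed.

(** A class of functions stable under differentiation consists of smooth functions: choice selects a
    derivative inside the class, and iterating this selection gives all derivatives. Pairing each
    function with its membership proof makes the iteration possible. *)
Lemma smooth_on_class (I : R -> Prop) (P : (R -> R) -> Prop) :
  (forall f, P f -> exists df, P df /\ D_on I f df) ->
  forall f, P f -> smooth_on I f.
Proof.
intros HP f Pf.
pose (next := fun g : {g | P g} =>
  let (d, Hd) := constructive_indefinite_description _ (HP (proj1_sig g) (proj2_sig g)) in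
  exist P d (proj1 Hd)).
assert (Hnext : forall g, D_on I (proj1_sig g) (proj1_sig (next g))).
{ intros g; unfold next.
  destruct constructive_indefinite_description as [d [Pd Hd]]; exact Hd. }
exists (fun n => proj1_sig (Nat.iter n next (exist P f Pf))); split;
  [reflexivity | intros n; apply Hnext].
Qed.

(* Closing under all the operations at once lets [smooth_on_class] replace
   Leibniz-type formulas for the n-th derivatives. *)
Inductive smooth_expr (I : R -> Prop) : (R -> R) -> Prop :=
| smooth_expr_base f : smooth_on I f -> smooth_expr I f
| smooth_expr_plus f g :
    smooth_expr I f -> smooth_expr I g -> smooth_expr I (fun s => f s + g s)
| smooth_expr_mult f g :
    smooth_expr I f -> smooth_expr I g -> smooth_expr I (fun s => f s * g s)
| smooth_expr_const c : smooth_expr I (fun _ => c)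
| smooth_expr_inv f :
    smooth_expr I f -> (forall s, I s -> f s <> 0) -> smooth_expr I (fun s => / f s)
| smooth_expr_sqrt f :
    smooth_expr I f -> (forall s, I s -> 0 < f s) -> smooth_expr I (fun s => sqrt (f s)).

Lemma smooth_expr_smooth (I : R -> Prop) (f : R -> R) :
  smooth_expr I f -> smooth_on I f.
Proof.
revert f; apply smooth_on_class; intros f Hf.
induction Hf as [f Hf | f g Hf [df [Sf Df]] Hg [dg [Sg Dg]]
  | f g Hf [df [Sf Df]] Hg [dg [Sg Dg]] | c | f Hf [df [Sf Df]] Hn | f Hf [df [Sf Df]] Hp].
- destruct (smooth_on_D_on I f Hf) as [df [Sf Df]].
  exists df; split; [constructor |]; assumption.
- exists (fun s => df s + dg s); split;
    [apply smooth_expr_plus | apply D_on_plus]; assumption.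
- exists (fun s => df s * g s + f s * dg s); split;
    [apply smooth_expr_plus; apply smooth_expr_mult | apply D_on_mult]; assumption.
- exists (fun _ => 0); split; [apply smooth_expr_const | apply D_on_const].
- exists (fun s => df s * (- 1 * (/ f s * / f s))); split;
    [| apply D_on_inv; assumption].
  repeat (apply smooth_expr_mult || apply smooth_expr_const || apply smooth_expr_inv);
    assumption.
- exists (fun s => df s * (/ 2 * / sqrt (f s))); split;
    [| apply D_on_sqrt; assumption].
  apply smooth_expr_mult; [assumption |].
  apply smooth_expr_mult; [apply (smooth_expr_const I (/ 2)) |].
  apply smooth_expr_inv; [apply smooth_expr_sqrt; assumption |].
  intros s Is; apply Rgt_not_eq, sqrt_lt_R0, Hp, Is.
Qed.

(** * Lifting plane vectors of constant length to an angle function *)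

Lemma cos_sin_exists (u v : R) :
  u * u + v * v = 1 -> exists a, cos a = u /\ sin a = v.
Proof.
intros H.
assert (Hu : - 1 <= u <= 1) by nra.
assert (Hs : sqrt (1 - u²) = Rabs v).
{ rewrite <- sqrt_Rsqr_abs; f_equal; unfold Rsqr; lra. }
destruct (Rle_or_lt 0 v) as [Hv | Hv].
- exists (acos u); split; [apply cos_acos, Hu |].
  rewrite sin_acos, Hs, Rabs_right by lra; reflexivity.
- exists (- acos u); rewrite cos_neg, sin_neg; split; [apply cos_acos, Hu |].
  rewrite sin_acos, Hs, Rabs_left by lra; ring.
Qed.

(* If [u^2 + v^2 = 1] then [u' = - w v] and [v' = w u], so that
   [u cos W + v sin W] is constant whenever [W' = w]. *)
Lemma angle_lift (I : R -> Prop) (u du v dv W w : R -> R) (s0 : R) :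
  interval I -> D_on I u du -> D_on I v dv -> D_on I W w ->
  (forall s, I s -> u s * u s + v s * v s = 1) ->
  (forall s, I s -> w s = u s * dv s - v s * du s) -> I s0 ->
  exists a, forall s, I s -> u s = cos (a + W s) /\ v s = sin (a + W s).
Proof.
intros HI Hu Hv HW Huv Hw I0.
destruct (cos_sin_exists (u s0) (v s0) (Huv s0 I0)) as [b [Hb1 Hb2]].
(* Chosen so that the lifted angle takes the value [b] at [s0]. *)
exists (b - W s0).
(* Differentiate the constant [u^2 + v^2] in two ways. *)
assert (Horth : forall s, I s -> u s * du s + v s * dv s = 0).
{ intros s Is.
  assert (H : (du s * u s + u s * du s) + (dv s * v s + v s * dv s) = 0).
  { apply (D_on_unique I (fun t => u t * u t + v t * v t)
      (fun t => (du t * u t + u t * du t) + (dv t * v t + v t * dv t)) (fun _ => 0));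
      [exact HI | | | exact Is].
    - apply D_on_plus; apply D_on_mult; assumption.
    - apply (D_on_ext I (fun _ => 1) _ (fun _ => 0));
        [intros t It; symmetry; auto | reflexivity | apply D_on_const]. }
  lra. }
set (T := fun s => b - W s0 + W s).
assert (HT : D_on I T (fun s => 0 + w s)).
{ apply D_on_plus; [apply D_on_const | exact HW]. }
assert (HC : D_on I (fun s => cos (T s)) (fun s => (0 + w s) * - sin (T s))).
{ apply (D_on_comp I T _ cos (fun y => - sin y) HT).
  intros s _; auto_derive; [exact Logic.I | ring]. }
assert (HS : D_on I (fun s => sin (T s)) (fun s => (0 + w s) * cos (T s))).
{ apply (D_on_comp I T _ sin cos HT).
  intros s _; auto_derive; [exact Logic.I | ring]. }
assert (Hconst : forall s, I s -> u s * cos (T s) + v s * sin (T s) = 1).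
{ intros s Is.
  rewrite (D_on_zero_const I (fun s => u s * cos (T s) + v s * sin (T s)) HI) with (b := s0);
    trivial.
  - unfold T; replace (b - W s0 + W s0) with b by ring.
    rewrite Hb1, Hb2; apply Huv, I0.
  - eapply D_on_ext; [reflexivity | |
      apply D_on_plus; apply D_on_mult; [exact Hu | exact HC | exact Hv | exact HS]].
    intros t It; cbv beta.
    assert (H1 := Horth t It); assert (H2 := Huv t It).
    assert (E1 : du t = - (w t * v t)).
    { rewrite (Hw t It).
      transitivity (du t * (u t * u t + v t * v t) - u t * (u t * du t + v t * dv t));
        [rewrite H1, H2 |]; ring. }
    assert (E2 : dv t = w t * u t).
    { rewrite (Hw t It).
      transitivity (dv t * (u t * u t + v t * v t) - v t * (u t * du t + v t * dv t));
        [rewrite H1, H2 |]; ring. }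
    rewrite E1, E2; ring. }
intros s Is; fold (T s).
assert (H1 := Hconst s Is); assert (H2 := Huv s Is).
assert (H3 := sin2_cos2 (T s)); unfold Rsqr in H3.
(* Two unit vectors with inner product 1 coincide: their squared distance is [1 + 1 - 2]. *)
assert (H4 : (u s - cos (T s)) * (u s - cos (T s)) + (v s - sin (T s)) * (v s - sin (T s)) = 0)
  by lra.
apply Rplus_sqr_eq_0 in H4; split; lra.
Qed.

Lemma smooth_angle_lift (I : R -> Prop) (u v : R -> R) (s0 : R) :
  interval I -> smooth_on I u -> smooth_on I v ->
  (forall s, I s -> u s * u s + v s * v s = 1) -> I s0 ->
  exists omega, smooth_on I omega /\
    forall s, I s -> u s = cos (omega s) /\ v s = sin (omega s).
Proof.
intros HI Su Sv Huv I0.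
destruct (smooth_on_D_on I u Su) as [du [Sdu Du]].
destruct (smooth_on_D_on I v Sv) as [dv [Sdv Dv]].
pose (w := fun s => u s * dv s + - 1 * (v s * du s)).
assert (Sw : smooth_on I w).
{ apply smooth_expr_smooth.
  apply smooth_expr_plus; repeat apply smooth_expr_mult;
    try apply smooth_expr_const; apply smooth_expr_base; assumption. }
assert (DW : D_on I (fun s => RInt w s0 s) w).
{ apply D_on_RInt; trivial; apply smooth_on_continue_in, Sw. }
destruct (angle_lift I u du v dv _ w s0 HI Du Dv DW Huv) as [a Ha]; trivial.
{ intros s _; unfold w; ring. }
exists (fun s => a + RInt w s0 s); split; [| exact Ha].
apply (smooth_on_primitive I _ (fun s => 0 + w s)).
- apply D_on_plus; [apply D_on_const | exact DW].
- apply (smooth_on_ext I w); [intros; ring | exact Sw].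
Qed.

Lemma smooth_angle_lift_scaled (I : R -> Prop) (u v : R -> R) (k s0 : R) :
  interval I -> smooth_on I u -> smooth_on I v ->
  (forall s, I s -> u s * u s + v s * v s = k * k) -> I s0 ->
  exists omega, smooth_on I omega /\
    forall s, I s -> u s = k * cos (omega s) /\ v s = k * sin (omega s).
Proof.
intros HI Su Sv Huv I0.
(* For [k = 0] the vector vanishes and the zero angle serves. Otherwise divide by [k], whatever its
   sign. *)
destruct (Req_dec k 0) as [-> | Hk].
- exists (fun _ => 0); split; [apply smooth_expr_smooth, smooth_expr_const |].
  intros s Is; assert (H := Huv s Is); rewrite Rmult_0_l in H.
  apply Rplus_sqr_eq_0 in H; lra.
- assert (Sk : forall f, smooth_on I f -> smooth_on I (fun s => / k * f s)).
  { intros f Sf; apply smooth_expr_smooth.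
    apply (smooth_expr_mult I (fun _ => / k)); constructor; exact Sf. }
  destruct (smooth_angle_lift I (fun s => / k * u s) (fun s => / k * v s) s0)
    as [omega [So Ho]]; auto.
  { intros s Is.
    transitivity (/ k * / k * (u s * u s + v s * v s)); [ring |].
    rewrite (Huv s Is); field; exact Hk. }
  exists omega; split; [exact So |]; intros s Is.
  destruct (Ho s Is) as [<- <-]; split; field; exact Hk.
Qed.

(** * The constant angle curve in cylindrical coordinates *)

Theorem theorem2 :
  forall (I : R -> Prop) (gamma dgamma : R -> E3) (theta s0 : R),
    interval I ->
    smooth_curve_on I gamma ->
    velocity_on I gamma dgamma ->
    (forall s, I s -> enorm (dgamma s) = 1) ->
    (forall s, I s -> ~ on_z_axis (gamma s)) ->
    constant_angle_with_V I gamma dgamma theta ->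
    I s0 ->
    exists (alpha c r0 : R) (omega : R -> R),
      smooth_on I omega /\
      let r := fun s => r0 + sin theta * RInt (fun t => cos (omega t)) s0 s in
      let z := fun s => sin theta * RInt (fun t => sin (omega t)) s0 s in
      let phi := fun s => cos theta * RInt (fun t => / r t) s0 s in
      forall s, I s ->
        0 < r s /\
        r s = dist_z_axis (gamma s) /\
        translate_z c (rotate_z alpha (gamma s)) =
          cylindrical (r s) (phi s) (z s).
Proof.
intros I gamma dgamma theta s0 HI [Sx [Sy Sz]] Hvel Hunit Haxis Hangle I0.
set (x := fun s => xcoord (gamma s)) in *.
set (y := fun s => ycoord (gamma s)) in *.
set (z := fun s => zcoord (gamma s)) in *.
pose (dx := fun s => xcoord (dgamma s)).
pose (dy := fun s => ycoord (dgamma s)).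
pose (dz := fun s => zcoord (dgamma s)).
assert (Dx : D_on I x dx) by (intros s Is; apply (Hvel s Is)).
assert (Dy : D_on I y dy) by (intros s Is; apply (Hvel s Is)).
assert (Dz : D_on I z dz) by (intros s Is; apply (Hvel s Is)).
assert (Sdx := smooth_on_derivative I x dx HI Sx Dx).
assert (Sdy := smooth_on_derivative I y dy HI Sy Dy).
assert (Sdz := smooth_on_derivative I z dz HI Sz Dz).
assert (Hspeed : forall s, I s -> dx s * dx s + dy s * dy s + dz s * dz s = 1).
{ intros s Is; change (inner (dgamma s) (dgamma s) = 1).
  specialize (Hunit s Is); unfold enorm in Hunit.
  rewrite <- (sqrt_sqrt (inner (dgamma s) (dgamma s))), Hunit; [ring |].
  unfold inner; nra. }
pose (rho := fun s => sqrt (x s * x s + y s * y s)).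
assert (Hpos : forall s, I s -> 0 < x s * x s + y s * y s).
{ intros s Is; destruct (Rle_or_lt (x s * x s + y s * y s) 0) as [H |]; [| assumption].
  exfalso; apply (Haxis s Is), (Rplus_sqr_eq_0 (x s) (y s)); unfold Rsqr; nra. }
assert (Hrho : forall s, I s -> 0 < rho s).
{ intros s Is; apply sqrt_lt_R0, Hpos, Is. }
assert (Hrho2 : forall s, I s -> rho s * rho s = x s * x s + y s * y s).
{ intros s Is; apply sqrt_sqrt, Rlt_le, Hpos, Is. }
assert (Hdist : forall s, rho s = dist_z_axis (gamma s)).
{ intros s; unfold rho, dist_z_axis; f_equal; unfold x, y; ring. }
assert (Hang : forall s, I s -> x s * dy s - y s * dx s = rho s * cos theta).
{ intros s Is; specialize (Hangle s Is).
  replace (rho s) with (enorm (V (gamma s))).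
  - rewrite <- Hangle; unfold inner, V, x, y, dx, dy, xcoord, ycoord, zcoord; simpl; ring.
  - unfold enorm, rho; f_equal; unfold inner, V, x, y, xcoord, ycoord, zcoord; simpl; ring. }
(* This is [(x x' + y y') / rho], in the shape produced by [D_on_sqrt] and [D_on_mult]. *)
pose (drho := fun s => (dx s * x s + x s * dx s + (dy s * y s + y s * dy s)) * (/ 2 * / rho s)).
assert (Drho : D_on I rho drho).
{ apply D_on_sqrt; [exact Hpos |].
  apply D_on_plus; apply D_on_mult; assumption. }
assert (Srho : smooth_on I rho).
{ apply smooth_expr_smooth, smooth_expr_sqrt; [| exact Hpos].
  apply smooth_expr_plus; apply smooth_expr_mult; apply smooth_expr_base; assumption. }
assert (Sdrho := smooth_on_derivative I rho drho HI Srho Drho).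
assert (Hmeridian : forall s, I s -> drho s * drho s + dz s * dz s = sin theta * sin theta).
{ intros s Is; specialize (Hrho s Is); specialize (Hrho2 s Is); specialize (Hang s Is).
  assert (H1 : rho s * drho s = x s * dx s + y s * dy s).
  { unfold drho; field; lra. }
  (* Lagrange's identity [(x x' + y y')^2 + (x y' - y x')^2 = (x^2 + y^2) (x'^2 + y'^2)], divided by
     [rho^2]: the horizontal velocity splits into a radial part [rho'] and an angular part
     [cos theta]. *)
  assert (H2 : drho s * drho s + cos theta * cos theta = dx s * dx s + dy s * dy s).
  { apply (Rmult_eq_reg_l (rho s * rho s)); [| nra].
    transitivity ((rho s * drho s) * (rho s * drho s)
                  + (rho s * cos theta) * (rho s * cos theta)); [ring |].
    rewrite H1, <- Hang, Hrho2; ring. }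
  specialize (Hspeed s Is); assert (H3 := sin2_cos2 theta); unfold Rsqr in H3; lra. }
destruct (smooth_angle_lift_scaled I drho dz (sin theta) s0 HI Sdrho Sdz Hmeridian I0)
  as [omega [Somega Homega]].
destruct (smooth_on_D_on I omega Somega) as [domega [_ Domega]].
assert (Cinv : forall s, I s -> continue_in (fun t => / rho t) I s).
{ apply smooth_on_continue_in, smooth_expr_smooth, smooth_expr_inv;
    [apply smooth_expr_base, Srho |].
  intros s Is; apply Rgt_not_eq, Hrho, Is. }
(* The terms in [dinv] cancel in [u v' - v u'] for [(u, v) = (x, y) / rho], so no formula for it is
   required. *)
destruct (smooth_on_D_on I (fun s => / rho s)) as [dinv [_ Dinv]].
{ apply smooth_expr_smooth, smooth_expr_inv; [apply smooth_expr_base, Srho |].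
  intros s Is; apply Rgt_not_eq, Hrho, Is. }
destruct (angle_lift I
    (fun s => x s * / rho s) (fun s => dx s * / rho s + x s * dinv s)
    (fun s => y s * / rho s) (fun s => dy s * / rho s + y s * dinv s)
    (fun s => cos theta * RInt (fun t => / rho t) s0 s)
    (fun s => 0 * RInt (fun t => / rho t) s0 s + cos theta * / rho s) s0)
  as [phi0 Hphi]; trivial.
{ apply D_on_mult; assumption. }
{ apply D_on_mult; assumption. }
{ apply D_on_mult; [apply D_on_const | apply D_on_RInt; assumption]. }
{ intros s Is; specialize (Hrho s Is); specialize (Hrho2 s Is).
  transitivity ((x s * x s + y s * y s) * (/ rho s * / rho s)); [ring |].
  rewrite <- Hrho2; field; lra. }
{ intros s Is; specialize (Hrho s Is).
  transitivity ((x s * dy s - y s * dx s) * (/ rho s * / rho s)); [| ring].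
  rewrite (Hang s Is); field; lra. }
(* [rho] is a primitive of [sin theta cos omega]; likewise [z] below is one of
   [sin theta sin omega]. *)
assert (Hr : forall s, I s ->
  rho s0 + sin theta * RInt (fun t => cos (omega t)) s0 s = rho s).
{ intros s Is.
  rewrite (scal_RInt_D_on I rho (fun t => cos (omega t)) (sin theta)); trivial; [ring | |].
  - apply (D_on_ext I rho rho drho); trivial; intros t It; apply Homega, It.
  - intros t It; refine (cont_deriv _ _ _ _ (D_on_comp I omega domega cos (fun v => - sin v) Domega _ t It)).
    intros v _; auto_derive; [exact Logic.I | ring]. }
assert (Hz : forall s, I s ->
  sin theta * RInt (fun t => sin (omega t)) s0 s = z s - z s0).
{ intros s Is.
  apply (scal_RInt_D_on I z (fun t => sin (omega t)) (sin theta)); trivial.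
  - apply (D_on_ext I z z dz); trivial; intros t It; apply Homega, It.
  - intros t It; refine (cont_deriv _ _ _ _ (D_on_comp I omega domega sin cos Domega _ t It)).
    intros v _; auto_derive; [exact Logic.I | ring]. }
(* The motion brings the starting point to polar angle 0 and height 0; [r0] is its distance to the
   axis. *)
exists (- phi0), (- z s0), (rho s0), omega; split; [exact Somega |].
intros r zz phi s Is.
assert (Er : r s = rho s) by (apply Hr, Is).
assert (Ephi : phi s = cos theta * RInt (fun t => / rho t) s0 s).
(* [r] and [rho] are known to agree on [I] only, and convexity keeps the integration range inside
   [I]. *)
{ unfold phi; f_equal; apply RInt_ext; intros t Ht; f_equal; apply Hr.
  revert Ht; unfold Rmin, Rmax; destruct Rle_dec; intros Ht.
  - apply (proj2 HI s0 s); trivial; lra.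
  - apply (proj2 HI s s0); trivial; lra. }
split; [rewrite Er; apply Hrho, Is |].
split; [rewrite Er; apply Hdist |].
destruct (Hphi s Is) as [Hc Hs]; rewrite <- Ephi in Hc, Hs.
assert (Ex : xcoord (gamma s) = rho s * cos (phi0 + phi s)).
{ rewrite <- Hc; specialize (Hrho s Is); change (xcoord (gamma s)) with (x s); field; lra. }
assert (Ey : ycoord (gamma s) = rho s * sin (phi0 + phi s)).
{ rewrite <- Hs; specialize (Hrho s Is); change (ycoord (gamma s)) with (y s); field; lra. }
(* In this form the addition formulas reproduce the rotation by [- phi0]. *)
replace (phi s) with (- phi0 + (phi0 + phi s)) by ring.
change ((cos (- phi0) * xcoord (gamma s) - sin (- phi0) * ycoord (gamma s),
         sin (- phi0) * xcoord (gamma s) + cos (- phi0) * ycoord (gamma s),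
         z s + - z s0) =
        (r s * cos (- phi0 + (phi0 + phi s)), r s * sin (- phi0 + (phi0 + phi s)), zz s)).
rewrite Ex, Ey, Er, (cos_plus (- phi0)), (sin_plus (- phi0)).
unfold zz; rewrite (Hz s Is).
f_equal; f_equal; ring.
Qed.
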